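(* Let $(\mathcal H_n)_{n\in\overline{\mathbb N}}$ be Hilbert spaces and let $(J_n:\mathcal H_n\to\mathcal H_\infty)_{n\in\mathbb N}$ be a sequence of contractions (i.e. $\|J_n\|\le1$). Fix $n\in\mathbb N$, and put $\mathcal H_n'=(\ker J_n)^\perp\subset\mathcal H_n$ and $\mathcal H_\infty'=(\ker J_n^* )^\perp\subset\mathcal H_\infty$. Then the following assertions are equivalent, where in each of (b), (c), (d) both the version ''for one parent space'' and the version ''for all parent spaces'' are meant, and both versions belong to the list of equivalent assertions: (a) $J_n$ is a partial isometry. (b) For one parent space (for all parent spaces) $\mathcal H$ with corresponding isometries $(\iota_k:\mathcal H_k\to\mathcal H)_{k\in\overline{\mathbb N}}$ factorising $(J_k)_{k\in\mathbb N}$ we have $\iota_n(\mathcal H_n)\cap\iota_\infty(\mathcal H_\infty)=\iota_n(\mathcal H_n')$. (c) For one parent space (for all parent spaces) $\mathcal H$ with corresponding isometries $(\iota_k:\mathcal H_k\to\mathcal H)_{k\in\overline{\mathbb N}}$ factorising $(J_k)_{k\in\mathbb N}$ we have $\iota_n(\mathcal H_n)\cap\iota_\infty(\mathcal H_\infty)=\iota_\infty(\mathcal H_\infty')$. (d) For one parent space (for all parent spaces) $\mathcal H$ with corresponding isometries $(\iota_k:\mathcal H_k\to\mathcal H)_{k\in\overline{\mathbb N}}$ factorising $(J_k)_{k\in\mathbb N}$, the orthogonal projections $P_n=\iota_n\iota_n^*$ and $P_\infty=\iota_\infty\iota_\infty^*$ satisfy $P_nP_\infty=P_\infty P_n$.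
   Context: All Hilbert spaces are complex and separable; $\mathbb N=\{1,2,\dots\}$, $\overline{\mathbb N}=\mathbb N\cup\{\infty\}$. A parent space for $(\mathcal H_k)_{k\in\overline{\mathbb N}}$ is a Hilbert space $\mathcal H$ together with isometries $\iota_k:\mathcal H_k\to\mathcal H$ for all $k\in\overline{\mathbb N}$; these isometries factorise $(J_k)_{k\in\mathbb N}$ if $J_k=\iota_\infty^*\iota_k$ for all $k\in\mathbb N$. A partial isometry is a bounded operator whose restriction to the orthogonal complement of its kernel is an isometry. *)

(* Defs.v *)
From HB Require Import structures.
From mathcomp Require Import all_boot all_order all_algebra.
From mathcomp Require Import complex.
From mathcomp Require Import all_classical all_reals all_analysis.

Set Implicit Arguments.
Unset Strict Implicit.
Unset Printing Implicit Defensive.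

Import Order.TTheory GRing.Theory Num.Theory.
Import numFieldNormedType.Exports.

Local Open Scope classical_set_scope.
Local Open Scope complex_scope.
Local Open Scope ring_scope.

(* {dot V for Num.conj} is linear in its first argument and conjugate-linear in
   its second. *)
HB.mixin Record NormedModule_isHilbert (R : realType) V
    of NormedModule R[i] V := {
  inner : {dot V for @Num.conj R[i]} ;
  normE_inner : forall x : V, `|x| ^+ 2 = inner x x
}.

#[short(type="hilbertType")]
HB.structure Definition Hilbert (R : realType) :=
  {V of CompleteNormedModule R[i] V & NormedModule_isHilbert R V}.

Definition separable_space (T : topologicalType) : Prop :=
  exists2 D : set T, countable D & dense D.

Section Operators.
Context {R : realType}.
Implicit Types U V : hilbertType R.

(* adjoint A y is the z with <A x, y> = <x, z> for all x, which exists and is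
   unique when A is linear and bounded; the default value 0 is then unused. *)
Definition adjoint U V (A : U -> V) (y : V) : U :=
  xget 0 [set z : U | forall x : U, inner (A x) y = inner x z].

Definition ker U V (A : U -> V) : set U := [set x | A x = 0].

Definition orth U (S : set U) : set U :=
  [set x | forall y, S y -> inner x y = 0].

Definition linear_contraction U V (A : {linear U -> V}) : Prop :=
  forall x, `|A x| <= `|x|.

Definition partial_isometry U V (A : {linear U -> V}) : Prop :=
  bounded_near A (nbhs (0 : U)) /\
  (forall x, orth (ker A) x -> `|A x| = `|x|).

End Operators.

(* Families indexed by the extended naturals are indexed by option nat, None
   being the index at infinity. *)
Record parentSpace (R : realType) (H : option nat -> hilbertType R) :=
  ParentSpace {
    parent_carrier :> hilbertType R ;
    parent_separable : separable_space parent_carrier ;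
    parent_iota : forall k : option nat, {linear H k -> parent_carrier} ;
    parent_isometry : forall (k : option nat) (x : H k),
      `|parent_iota k x| = `|x|
  }.

Definition factorises (R : realType) (H : option nat -> hilbertType R)
    (P : parentSpace H)
    (J : forall k : nat, {linear H (Some k) -> H None}) : Prop :=
  forall k : nat,
    J k =1 adjoint (parent_iota P None) \o parent_iota P (Some k).

Definition parent_proj (R : realType) (H : option nat -> hilbertType R)
    (P : parentSpace H) (k : option nat) : P -> P :=
  parent_iota P k \o adjoint (parent_iota P k).
Arguments parent_proj {R H} P k.

(* Main.v *)
(* Write A = J_n. Every condition is equivalent to the operator identity
   A A* A = A, which does not mention the parent space. For a contraction,
   |A x| = |x| forces A* A x = x, so that {x | |A x| = |x|} always lies in the
   orthogonal complement of ker A, with equality iff A A* A = A. In a parent space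
   factorising J, iota_n x lies in the range of iota_oo iff |A x| = |x|, which
   settles (b) and, with A* in place of A, (c); (d) says that
   iota_n A* iota_oo^* = iota_oo A iota_n^*.

   The "one" and "all" versions agree because a parent space exists. On the
   disjoint union of the H_k consider the kernel <J_k x, J_l y> +
   [k = l] (<x, y> - <J_k x, J_k y>), with J_oo = 1, which is positive semidefinite
   since the J_k are contractions. Taking Schur complements along a dense sequence
   (a Cholesky decomposition) realises it as the Gram kernel of a map into l2. *)

Require Import Defs.
From HB Require Import structures.
From mathcomp Require Import all_boot all_order all_algebra.
From mathcomp Require Import complex ring lra.
From mathcomp Require Import all_classical all_reals all_analysis.

Set Implicit Arguments.
Unset Strict Implicit.
Unset Printing Implicit Defensive.

Import Order.TTheory GRing.Theory Num.Theory.
Import numFieldNormedType.Exports.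

Local Open Scope classical_set_scope.
Local Open Scope ring_scope.

(** * Inner products and adjoint pairs *)

Section DotProduct.
Variables (C : numClosedFieldType) (V : lmodType C) (f : {dot V for @Num.conj C}).
Implicit Types x y z : V.

Lemma dotC x y : f x y = (f y x)^*.
Proof. by rewrite hermC expr0 mul1r. Qed.

Lemma dot_ge0 x : 0 <= f x x.
Proof.
by have [->|/neq0_dnorm_gt0/ltW//] := eqVneq x 0; rewrite linear0l.
Qed.

Lemma dot_eq0 x : f x x = 0 -> x = 0.
Proof.
by move=> fx0; apply/eqP/negPn/negP => /(neq0_dnorm_gt0 (s := f)); rewrite fx0 ltxx.
Qed.

Lemma dotZl a x y : f (a *: x) y = a * f x y.
Proof. exact: linearZl_LR. Qed.

Lemma dotZr a x y : f x (a *: y) = a^* * f x y.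
Proof. exact: linearZr_LR. Qed.

Lemma dot_sqrD x y : f (x + y) (x + y) = f x x + f y y + (f x y + (f x y)^*).
Proof. by rewrite hnormD expr0 mul1r. Qed.

Lemma dot_sqrB x y : f (x - y) (x - y) = f x x + f y y - (f x y + (f x y)^*).
Proof. by rewrite hnormB expr0 mul1r. Qed.

(** The vector [f y y *: x - f x y *: y] is [f y y] times the part of [x] orthogonal to [y]; its
    square is [f y y] times the gap in the inequality. *)
Lemma dot_CauchySchwarz x y : `|f x y| ^+ 2 <= f x x * f y y.
Proof.
have [->|y0] := eqVneq y 0; first by rewrite linear0r normr0 expr0n linear0l; rewrite mulr0.
have fy : 0 < f y y by exact: neq0_dnorm_gt0.
have := dot_ge0 (f y y *: x - f x y *: y).
rewrite dot_sqrB !(dotZl, dotZr) rmorphM/= !rmorphM/= conjCK.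
rewrite -(dotC y y) -(dotC y x) normCK -(dotC y x).
set a := f x x; set b := f y y; set c := f x y; set d := f y x.
have -> : b * (b * a) + c * (d * b) - (b * (d * c) + b * (c * d)) = b * (a * b - c * d) by ring.
by rewrite pmulr_rge0// subr_ge0.
Qed.

(** This lemma and the next two are the norm axioms for [sqrtC (f x x)], stated without a norm on
    [V] because they serve to define the one of [l2]. *)
Lemma ler_dot_sqrtD x y : sqrtC (f (x + y) (x + y)) <= sqrtC (f x x) + sqrtC (f y y).
Proof.
have ? := dot_ge0 x; have ? := dot_ge0 y; have ? := dot_ge0 (x + y).
rewrite -(@ler_pXn2r _ 2)// ?nnegrE ?addr_ge0 ?sqrtC_ge0// sqrrD !sqrtCK dot_sqrD.
rewrite [leRHS]addrAC lerD2l.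
have le_d : `|f x y| <= sqrtC (f x x) * sqrtC (f y y).
  rewrite -(@ler_pXn2r _ 2)// ?nnegrE ?mulr_ge0 ?sqrtC_ge0//.
  by rewrite exprMn !sqrtCK dot_CauchySchwarz.
apply: (@le_trans _ _ (`|f x y| *+ 2)); last by rewrite lerMn2r le_d orbT.
have re_d : f x y + (f x y)^* \is Num.real.
  by rewrite CrealE rmorphD/= conjCK addrC.
rewrite (le_trans (real_ler_norm re_d))// (le_trans (ler_normD _ _))//.
by rewrite norm_conjC mulr2n.
Qed.

Lemma dot_sqrtZ a x : sqrtC (f (a *: x) (a *: x)) = `|a| * sqrtC (f x x).
Proof.
rewrite dotZl dotZr mulrA -normCK sqrtCM ?nnegrE ?exprn_ge0 ?dot_ge0//.
by rewrite sqrCK.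
Qed.

Lemma dot_sqrt_eq0 x : sqrtC (f x x) = 0 -> x = 0.
Proof. by move/eqP; rewrite sqrtC_eq0 => /eqP/dot_eq0. Qed.

End DotProduct.

Section Hilbert.
Variables (R : realType) (V : hilbertType R).
Implicit Types x y z : V.
Local Notation C := R[i].

Lemma innerC x y : inner x y = (inner y x)^*. Proof. exact: dotC. Qed.

Lemma innerZl a x y : inner (a *: x) y = a * inner x y. Proof. exact: dotZl. Qed.

Lemma innerZr a x y : inner x (a *: y) = a^* * inner x y. Proof. exact: dotZr. Qed.

Lemma inner_CauchySchwarz x y : `|inner x y| <= `|x| * `|y|.
Proof.
rewrite -(@ler_pXn2r _ 2)// ?nnegrE ?mulr_ge0//.
by rewrite exprMn !normE_inner dot_CauchySchwarz.
Qed.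

Lemma inner_extr x y : (forall z, inner z x = inner z y) -> x = y.
Proof.
move=> xy; apply/eqP; rewrite -subr_eq0; apply/eqP/(dot_eq0 (f := inner)).
by rewrite linearBr /= xy subrr.
Qed.

Lemma norm_eq_inner (W : hilbertType R) x (w : W) :
  `|x| = `|w| <-> inner x x = inner w w.
Proof.
rewrite -!normE_inner; split=> [->//|/eqP].
by rewrite eqrXn2// => /eqP.
Qed.

End Hilbert.

Section AdjointPair.
Variable R : realType.

(** A symmetric relation between plain functions: a lemma on [A] then applies to its adjoint too,
    which is not bundled as a linear map. *)
Definition adjoint_pair (U V : hilbertType R) (A : U -> V) (B : V -> U) :=
  forall x y, inner (A x) y = inner x (B y).

Definition contractive (U V : hilbertType R) (A : U -> V) :=
  forall x, `|A x| <= `|x|.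

Lemma adjoint_pairC (U V : hilbertType R) (A : U -> V) (B : V -> U) :
  adjoint_pair A B -> adjoint_pair B A.
Proof. by move=> AB y x; rewrite innerC -AB -innerC. Qed.

Lemma adjoint_pair_norm (U V : hilbertType R) (A : U -> V) (B : V -> U) x :
  adjoint_pair A B -> B (A x) = x -> `|A x| = `|x|.
Proof. by move=> AB BAx; apply/norm_eq_inner; rewrite AB BAx. Qed.

Lemma adjoint_pairB (U V : hilbertType R) (A : U -> V) (B : V -> U) x y :
  adjoint_pair A B -> A (x - y) = A x - A y.
Proof.
move=> /adjoint_pairC AB; apply: inner_extr => z.
by rewrite linearBr/= -!AB linearBr.
Qed.

Section one_pair.
Variables (U V : hilbertType R) (A : U -> V) (B : V -> U).
Hypotheses (AB : adjoint_pair A B) (cA : contractive A) (cB : contractive B).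

(** As [inner (B (A x)) x] is the square of the norm of [A x], hence of [x], expanding the square of
    [B (A x) - x] leaves the square of [B (A x)] minus that of [x], which is at most 0. *)
Lemma norm_adjointK x : `|A x| = `|x| -> B (A x) = x.
Proof.
move=> Ax; apply/eqP; rewrite -subr_eq0 -normr_eq0 -sqrf_eq0 normE_inner.
have -> : inner (B (A x) - x) (B (A x) - x) = `|B (A x)| ^+ 2 - `|x| ^+ 2.
  rewrite dot_sqrB -!normE_inner (adjoint_pairC AB) -normE_inner Ax.
  rewrite (_ : (`|x| ^+ 2)^* = `|x| ^+ 2); first by ring.
  by rewrite geC0_conj// exprn_ge0.
rewrite eq_le; apply/andP; split.
  by rewrite subr_le0 ler_pXn2r ?nnegrE// (le_trans (cB _)) ?Ax.
have := dot_ge0 inner (B (A x) - x); rewrite dot_sqrB -!normE_inner.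
rewrite (adjoint_pairC AB) -normE_inner Ax geC0_conj ?exprn_ge0//.
by set b := _ ^+ 2; set a := _ ^+ 2; have -> : b + a - (a + a) = b - a by ring.
Qed.

Lemma norm_orth_ker x : `|A x| = `|x| -> orth (ker A) x.
Proof.
by move=> /norm_adjointK <- y; rewrite /ker/= => Ay; rewrite (adjoint_pairC AB) Ay linear0r.
Qed.

Lemma adjoint_orth_ker y : orth (ker A) (B y).
Proof. by move=> x; rewrite /ker/= => Ax; rewrite (adjoint_pairC AB) Ax linear0r. Qed.

Lemma triple_adjoint : (forall x, A (B (A x)) = A x) -> forall y, B (A (B y)) = B y.
Proof.
move=> ABA y; apply: inner_extr => x.
by rewrite -AB -(adjoint_pairC AB) -AB ABA AB.
Qed.

(** If [A] is isometric on the complement of its kernel, it is so at every [B y], whence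
    [B A B = B], and adjoints give [A B A = A]. Conversely [B (A x) - x] lies in [ker A], and for
    [x] orthogonal to [ker A] it is also orthogonal to [ker A], hence 0. *)
Lemma isometric_orth_kerP :
  (forall x, orth (ker A) x -> `|A x| = `|x|) <-> (forall x, A (B (A x)) = A x).
Proof.
split=> [isoA|ABA x xo].
  have BAB y : B (A (B y)) = B y.
    by apply: norm_adjointK; apply/isoA/adjoint_orth_ker.
  move=> x; apply: inner_extr => y.
  by rewrite -(adjoint_pairC AB) -AB -(adjoint_pairC AB) BAB (adjoint_pairC AB).
apply: (adjoint_pair_norm AB); apply/eqP; rewrite -subr_eq0; apply/eqP.
apply: (dot_eq0 (f := inner)); rewrite [X in X = _]linearBl/=.
have k : ker A (B (A x) - x) by rewrite /ker/= (adjoint_pairB _ _ AB) ABA subrr.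
by rewrite (adjoint_orth_ker _ k) (xo _ k) subrr.
Qed.

End one_pair.
End AdjointPair.

(** * The Riesz representation theorem *)

Section ComplexNorm.
Variable R : realType.
Local Notation C := R[i].
Local Notation Re := complex.Re.
Local Notation Im := complex.Im.

Lemma ReD (x y : C) : Re (x + y) = Re x + Re y. Proof. by case: x y => [? ?] []. Qed.
Lemma ReN (x : C) : Re (- x) = - Re x. Proof. by case: x. Qed.
Lemma ReB (x y : C) : Re (x - y) = Re x - Re y. Proof. by rewrite ReD ReN. Qed.
Lemma ReZ (r : R) (x : C) : Re (r%:C%C * x) = r * Re x.
Proof. by case: x => a b /=; rewrite mul0r subr0. Qed.
Lemma Re_conj (x : C) : Re x^* = Re x.
Proof. by case: x. Qed.
Lemma Re_le (x y : C) : x <= y -> Re x <= Re y.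
Proof. by rewrite lecE => /andP[]. Qed.

Lemma gt0_real (e : C) : 0 < e -> exists2 r : R, 0 < r & e = r%:C%C.
Proof.
case: e => a b; rewrite ltcE/= => /andP[/eqP-> a0].
by exists a.
Qed.

Lemma ge0_Re (x : C) : 0 <= x -> (Re x)%:C%C = x.
Proof. by case: x => a b; rewrite lecE/= => /andP[/eqP-> _]. Qed.

(** The norm takes values in [R[i]]; its real counterpart lives in a totally ordered field, where
    [lra] and real limits are available. *)
Definition rnorm (V : normedModType C) (x : V) : R := Re `|x|.

Lemma rnormE (V : normedModType C) (x : V) : `|x| = (rnorm x)%:C%C.
Proof. by rewrite /rnorm ge0_Re ?normr_ge0. Qed.

Lemma rnorm_ge0 (V : normedModType C) (x : V) : 0 <= rnorm x.
Proof. by rewrite -lecR -rnormE normr_ge0. Qed.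

Lemma ler_rnormB (V : normedModType C) (x y z : V) : rnorm (x - z) <= rnorm (x - y) + rnorm (y - z).
Proof.
rewrite -lecR rmorphD/= -!rnormE.
by rewrite -[x - z](subrKA y) ler_normD.
Qed.

Lemma rnormC (V : normedModType C) (x y : V) : rnorm (x - y) = rnorm (y - x).
Proof. by rewrite /rnorm distrC. Qed.

Lemma rnorm_complete (V : completeNormedModType C) (u : nat -> V) :
  (forall e : R, 0 < e -> exists N : nat, forall m n, (N <= m)%N -> (N <= n)%N ->
     rnorm (u m - u n) < e) ->
  exists l : V, rnorm (u n - l) @[n --> \oo] --> (0 : R).
Proof.
move=> cu.
have : cauchy (u @ \oo).
  apply/cauchy_ballP => e /gt0_real[r r0 ->].
  have [N HN] := cu _ r0.
  exists (u @` [set n | (N <= n)%N], u @` [set n | (N <= n)%N]) => /=.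
    by split; exists N => // n Nn; exists n.
  move=> _ /= [[m Nm <-] [n Nn <-]].
  by rewrite -ball_normE/= rnormE ltcR; exact: HN.
move=> /cauchy_cvg/cvg_ex[l ul]; exists l.
apply/cvgrPdist_lt => e e0.
have e0' : 0 < e%:C%C :> C by rewrite ltcR.
move/cvgrPdist_lt : ul => /(_ _ e0')/= [N _ HN].
exists N => // n /HN/=; rewrite rnormE ltcR rnormC.
by rewrite sub0r normrN ger0_norm// rnorm_ge0.
Qed.

End ComplexNorm.

Section Riesz.
Variables (R : realType) (V : hilbertType R).
Local Notation C := R[i].
Local Notation Re := complex.Re.
Local Notation Im := complex.Im.
Implicit Types x y z : V.

Local Notation ip x y := (Re (inner x y)).

Local Lemma ipDl x y z : ip (x + y) z = ip x z + ip y z.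
Proof. by rewrite linearDl/= ReD. Qed.

Local Lemma ipC x y : ip x y = ip y x.
Proof. by rewrite innerC Re_conj. Qed.

Local Lemma ipDr x y z : ip z (x + y) = ip z x + ip z y.
Proof. by rewrite !(ipC z) ipDl. Qed.

Local Lemma ipZl (r : R) x y : ip (r%:C%C *: x) y = r * ip x y.
Proof. by rewrite innerZl ReZ. Qed.

Local Lemma ipZr (r : R) x y : ip x (r%:C%C *: y) = r * ip x y.
Proof. by rewrite !(ipC x) ipZl. Qed.

Local Lemma ipNl x y : ip (- x) y = - ip x y.
Proof. by rewrite linearNl/= ReN. Qed.

Local Lemma ipNr x y : ip x (- y) = - ip x y.
Proof. by rewrite !(ipC x) ipNl. Qed.

Lemma rnorm_sqr x : rnorm x ^+ 2 = ip x x.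
Proof. by rewrite -normE_inner rnormE -rmorphXn. Qed.

Lemma Re_inner_le x y : `|ip x y| <= rnorm x * rnorm y.
Proof.
rewrite -lecR rmorphM/= -!rnormE.
exact: le_trans (normc_ge_Re _) (inner_CauchySchwarz _ _).
Qed.

Variables (f : V -> C) (M : R).
Hypotheses (fD : forall x y, f (x + y) = f x + f y) (fZ : forall a x, f (a *: x) = a * f x).
Hypothesis fM : forall x, `|f x| <= (M * rnorm x)%:C%C.

Let g x := Re (f x).
(* Expanding [|x - z|^2], the minimiser of [phi] is the vector representing [f]. *)
Let phi x := ip x x - 2 * g x.

Let phiD x y t : phi (x + t%:C%C *: y) = phi x + t ^+ 2 * ip y y + 2 * t * (ip y x - g y).
Proof.
by rewrite /phi /g fD fZ ReD ReZ !(ipDl, ipDr, ipZl, ipZr) (ipC x y); ring.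
Qed.

(** Parallelogram law: the linear part of [phi] cancels, so points where [phi] is close to its
    infimum are close to each other. *)
Let phi_mid x y : ip (x - y) (x - y) = 2 * (phi x + phi y - 2 * phi ((2^-1)%:C%C *: (x + y))).
Proof.
rewrite /phi /g fZ ReZ fD ReD !(ipDl, ipDr, ipZl, ipZr, ipNl, ipNr) (ipC y x).
by field.
Qed.

Let phi_ge x : - M ^+ 2 <= phi x.
Proof.
have : g x <= M * rnorm x.
  rewrite (le_trans (ler_norm _))// -lecR.
  by rewrite (le_trans (normc_ge_Re _)).
have := sqr_ge0 (rnorm x - M).
rewrite /phi -rnorm_sqr => h1 h2; nra.
Qed.

(** Quantitative first-order condition: moving from [x] along [y] by the optimal step [- (b / q)]
    lowers [phi] by [b ^+ 2 / q], which can be at most [d]. *)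
Let quasi_min x d y : (forall z, phi x <= phi z + d) -> (g y - ip y x) ^+ 2 <= d * ip y y.
Proof.
move=> xmin.
have [->|y0] := eqVneq y 0.
  have -> : g 0 = 0 by rewrite /g -(scale0r y) fZ mul0r.
  by rewrite !linear0l/= subrr expr0n mulr0.
have q0 : 0 < ip y y.
  by have := neq0_dnorm_gt0 (s := inner) y y0; rewrite ltcE => /andP[].
set q := ip y y in q0 *; pose b := ip y x - g y.
have := xmin (x + (- (b / q))%:C%C *: y).
rewrite phiD -/q -/b => h.
rewrite -sqrrN opprB -/b mulrC -ler_pdivrMl//.
have -> : q^-1 * b ^+ 2 = - ((- (b / q)) ^+ 2 * q + 2 * - (b / q) * b).
  by field; exact: lt0r_neq0.
by lra.
Qed.

(** A minimising sequence of [phi] is Cauchy by [phi_mid], and [quasi_min] passes to its limit [z].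
    This settles the real parts. *)
Lemma riesz : exists z, forall x, f x = inner x z.
Proof.
have has_inf_phi : has_inf (range phi).
  split; first by exists (phi 0), 0.
  by exists (- M ^+ 2) => _ [x _ <-]; exact: phi_ge.
pose I := inf (range phi).
have Ile x : I <= phi x by apply: ge_inf; [case: has_inf_phi|exists x].
have /choice[u uI] (n : nat) : exists x, phi x < I + n.+1%:R^-1.
  have [|_ [x _ <-] xI] := inf_adherent (eps := n.+1%:R^-1) _ has_inf_phi.
    by rewrite invr_gt0.
  by exists x.
have [z uz] : exists z, rnorm (u n - z) @[n --> \oo] --> (0 : R).
  apply: rnorm_complete => e e0.
  (* Two values of [phi] within [e ^+ 2 / 4] of the infimum give, through the factors 2 in
     [phi_mid], a squared distance below [e ^+ 2]. *)
  have e20 : 0 < e ^+ 2 / 4 by rewrite divr_gt0// exprn_gt0.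
  have [N HN] : exists N : nat, forall n, (N <= n)%N -> n.+1%:R^-1 < e ^+ 2 / 4 :> R.
    have [N _ HN] := near_infty_natSinv_lt (PosNum e20).
    by exists N => n; exact: HN.
  exists N => m n Nm Nn.
  rewrite -(@ltr_pXn2r _ 2)// ?nnegrE ?rnorm_ge0 ?(ltW e0)// rnorm_sqr phi_mid.
  have := uI m; have := uI n; have := HN _ Nm; have := HN _ Nn.
  have := Ile ((2^-1)%:C%C *: (u m + u n)).
  set a := phi _; set b := phi _; set c := phi _; set p := m.+1%:R^-1; set q := n.+1%:R^-1.
  set E := e ^+ 2; lra.
have gz y : g y = ip y z.
  have ipz : (g y - ip y (u n)) ^+ 2 @[n --> \oo] --> (g y - ip y z) ^+ 2.
    have h : ip y (u n) @[n --> \oo] --> ip y z.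
      apply/cvgrPdist_le => e e0.
      (* The added 1 keeps the denominator positive when [y = 0]. *)
      have e0' : 0 < e / (rnorm y + 1) by rewrite divr_gt0// ltr_wpDl// rnorm_ge0.
      move/cvgrPdist_le : uz => /(_ _ e0'); apply: filterS => n.
      rewrite sub0r normrN ger0_norm ?rnorm_ge0// => un.
      rewrite -ReB -linearBr/= (le_trans (Re_inner_le _ _))// rnormC.
      move: un; rewrite ler_pdivlMr ?ltr_wpDl ?rnorm_ge0//.
      have := rnorm_ge0 (u n - z); nra.
    rewrite expr2; under eq_fun do rewrite expr2.
    by apply: cvgM; apply: cvgB => //; exact: cvg_cst.
  apply/eqP; rewrite -subr_eq0 -sqrf_eq0 -(rwP eqP); apply/eqP; rewrite eq_le sqr_ge0 andbT.
  have inv0 : n.+1%:R^-1 * ip y y @[n --> \oo] --> 0 * ip y y.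
    by apply: cvgMr_tmp; exact: cvg_harmonic.
  rewrite -(mul0r (ip y y)); apply: ler_cvg_to ipz inv0 _.
  near=> n; apply: quasi_min => x.
  by rewrite (le_trans (ltW (uI n)))// lerD2r.
exists z => x; apply/eqP; rewrite eq_complex; apply/andP; split; apply/eqP; first exact: gz.
(* The imaginary parts are, up to sign, the real parts at ['i *: x]. *)
have := gz ('i%C *: x); rewrite /g fZ innerZl.
case: (f x) (inner x z) => [a b] [c d] /=.
by rewrite !mul0r !mul1r !add0r => /oppr_inj.
Unshelve. all: by end_near. Qed.

End Riesz.

(** * Existence, uniqueness and norm of the adjoint *)

Section Adjoint.
Variables (R : realType) (U V : hilbertType R).

(** Riesz applied to [x |-> inner (A x) y], bounded by the norm of [y], rules out the default value
    of [xget]. *)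
Lemma adjointP (A : {linear U -> V}) : contractive A -> adjoint_pair A (adjoint A).
Proof.
move=> cA x y; rewrite /adjoint; case: xgetP => [z _ -> //|/(_ _) noz].
have [||| z zP] := @riesz R U (fun x => inner (A x) y) (rnorm y).
- by move=> a b; rewrite linearD linearDl.
- by move=> a b; rewrite linearZ/= innerZl.
- move=> a; rewrite rmorphM/= -!rnormE mulrC.
  by rewrite (le_trans (inner_CauchySchwarz _ _))// ler_wpM2r.
- by case: (noz z).
Qed.

Lemma contractive_adjoint (A : {linear U -> V}) : contractive A -> contractive (adjoint A).
Proof.
move=> cA y; have [->|By0] := eqVneq (adjoint A y) 0; first by rewrite normr0.
have B0 : 0 < `|adjoint A y| by rewrite normr_gt0.
rewrite -(ler_pM2l B0) -expr2 normE_inner -(adjointP cA).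
rewrite (le_trans (real_ler_norm _))//.
  by rewrite (adjointP cA) ger0_real// dot_ge0.
by rewrite (le_trans (inner_CauchySchwarz _ _))// ler_wpM2r.
Qed.

Lemma adjoint_unique (A : {linear U -> V}) (B : V -> U) : contractive A ->
  adjoint_pair A B -> adjoint A =1 B.
Proof. by move=> cA AB y; apply: inner_extr => x; rewrite -AB -(adjointP cA). Qed.

End Adjoint.

(** * Pairs of isometries into a common space *)

Section TwoIsometries.
Variables (R : realType) (U V W : hilbertType R).
Variables (i : {linear U -> W}) (j : {linear V -> W}).
Hypotheses (isoi : forall x, `|i x| = `|x|) (isoj : forall y, `|j y| = `|y|).

Let ci : contractive i. Proof. by move=> x; rewrite isoi. Qed.
Let cj : contractive j. Proof. by move=> x; rewrite isoj. Qed.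

Let iK x : adjoint i (i x) = x.
Proof. exact: norm_adjointK (adjointP ci) (contractive_adjoint ci) _ (isoi x). Qed.

Let jK x : adjoint j (j x) = x.
Proof. exact: norm_adjointK (adjointP cj) (contractive_adjoint cj) _ (isoj x). Qed.

Let A := adjoint j \o i.
Let B := adjoint i \o j.

Lemma adjoint_pair_isometries : adjoint_pair A B.
Proof.
by move=> x y; rewrite /A /B/= (adjoint_pairC (adjointP cj)) (adjointP ci).
Qed.

(** If [adjoint j] preserves the norm of [i x], then [norm_adjointK], applied with [adjoint j] first
    and [j] as its adjoint, gives [j (adjoint j (i x)) = i x]. *)
Lemma isometries_range x : `|A x| = `|x| <-> range j (i x).
Proof.
split=> [Ax|[y _ jy]]; last by rewrite /A/= -jy jK -isoj jy isoi.
exists (A x) => //.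
have : `|adjoint j (i x)| = `|i x| by rewrite isoi -Ax.
by move/(norm_adjointK (adjoint_pairC (adjointP cj)) cj).
Qed.

Lemma range_isometriesE : range i `&` range j = i @` [set x | `|A x| = `|x|].
Proof.
apply/seteqP; split=> [_ [[x _ <-] /isometries_range]|_ [x /isometries_range jx <-]].
  by exists x.
by split=> //; exists x.
Qed.

(** If [B A B = B], then [A] is isometric at [B y], so [i (B y)] is in the range of [j] and equals
    [j (A (B y))]. The product of the projections is thus [j A B] after [adjoint j], which is
    self-adjoint. Conversely, commutation evaluated at [j y] and followed by [adjoint i] reads
    [B y = B (A (B y))]. *)
Lemma range_isometries_commuteP :
  (forall x, A (B (A x)) = A x) <->
  ((i \o adjoint i) \o (j \o adjoint j) =1 (j \o adjoint j) \o (i \o adjoint i)).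
Proof.
have AB := adjoint_pair_isometries; split=> [ABA|PQ].
  have BAB := triple_adjoint AB ABA.
  have iB y : i (B y) = j (A (B y)).
    have : range j (i (B y)).
      by apply/isometries_range/(adjoint_pair_norm AB).
    by move=> [z _ jz]; rewrite -jz /A/= -jz jK.
  have Pij w : i (adjoint i (j (adjoint j w))) = j (A (B (adjoint j w))) by rewrite -iB.
  move=> w; apply: inner_extr => v /=.
  rewrite Pij -(adjoint_pairC (adjointP cj)) -(adjoint_pairC AB) -AB -(adjointP cj) -Pij.
  by rewrite (adjointP ci) (adjoint_pairC (adjointP ci)) (adjointP cj)
    (adjoint_pairC (adjointP cj)).
apply: (triple_adjoint (adjoint_pairC AB)) => y.
by have /= := PQ (j y); rewrite jK => /(congr1 (adjoint i)); rewrite iK.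
Qed.

End TwoIsometries.

(** * The conditions of the theorem as the identity [A A^* A = A] *)

Lemma partial_isometryP (R : realType) (U V : hilbertType R) (A : {linear U -> V}) :
  linear_contraction A ->
  partial_isometry A <-> (forall x, A (adjoint A (A x)) = A x).
Proof.
move=> cA; have /isometric_orth_kerP kP := adjointP cA.
split=> [[_ /kP]|/kP isoA]; [apply; exact: contractive_adjoint|].
split; last by apply: isoA; exact: contractive_adjoint.
rewrite /bounded_near; near=> M; apply/nbhs_ballP; exists 1 => //= x.
rewrite -ball_normE/= sub0r normrN => x1.
apply: le_trans (cA x) (le_trans (ltW x1) _).
by near: M; exact: nbhs_pinfty_ge.
Unshelve. all: by end_near. Qed.

Section ParentSpaces.
Variables (R : realType) (H : option nat -> hilbertType R).
Variables (J : forall k : nat, {linear H (Some k) -> H None}).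
Hypothesis (Jcontr : forall k : nat, linear_contraction (J k)).
Variables (n : nat) (P : parentSpace H).
Hypothesis PJ : factorises P J.

Let cJ : contractive (J n). Proof. exact: Jcontr. Qed.
Let JA := adjointP cJ.
Let cJa := contractive_adjoint cJ.
Let i := parent_iota P (Some n).
Let j := parent_iota P None.
Let isoi x : `|i x| = `|x|. Proof. exact: parent_isometry. Qed.
Let isoj x : `|j x| = `|x|. Proof. exact: parent_isometry. Qed.

Let JE : adjoint j \o i = J n. Proof. by apply/funext => x; rewrite [RHS]PJ. Qed.

Let JadjE : adjoint i \o j = adjoint (J n).
Proof.
apply/esym/funext; apply: adjoint_unique; first exact: cJ.
by rewrite -JE; exact: adjoint_pair_isometries isoi isoj.
Qed.

(** The intersection is the image under [i] of the vectors whose norm [J n] preserves. These always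
    lie in the complement of the kernel, and [i] is injective, so the equality says that [J n] is
    isometric on that complement. *)
Lemma parent_range_kerP :
  range i `&` range j = i @` orth (ker (J n)) <->
  (forall x, J n (adjoint (J n) (J n x)) = J n x).
Proof.
rewrite (range_isometriesE isoi isoj) JE -(isometric_orth_kerP JA cJa).
split=> [E x kx|isoJ].
  have : (i @` orth (ker (J n))) (i x) by exists x.
  rewrite -E => -[y /= Jy iyx].
  suff -> : x = y by [].
  apply/esym/eqP; rewrite -subr_eq0 -normr_eq0 -isoi linearB iyx subrr normr0 //.
congr (_ @` _); apply/seteqP; split=> x; last exact: isoJ.
exact: norm_orth_ker JA cJa _.
Qed.

(** The previous argument with [i] and [j] exchanged, hence with [adjoint (J n)] for [J n];
    [triple_adjoint] carries the identity across. *)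
Lemma parent_range_ker_adjointP :
  range i `&` range j = j @` orth (ker (adjoint (J n))) <->
  (forall x, J n (adjoint (J n) (J n x)) = J n x).
Proof.
rewrite setIC (range_isometriesE isoj isoi) JadjE.
have -> : (forall x, J n (adjoint (J n) (J n x)) = J n x) <->
  (forall y, adjoint (J n) (J n (adjoint (J n) y)) = adjoint (J n) y).
  by split; [exact: triple_adjoint|exact: (triple_adjoint (adjoint_pairC JA))].
rewrite -(isometric_orth_kerP (adjoint_pairC JA) cJ).
split=> [E x kx|isoJ].
  have : (j @` orth (ker (adjoint (J n)))) (j x) by exists x.
  rewrite -E => -[y /= Jy jyx].
  suff -> : x = y by [].
  apply/esym/eqP; rewrite -subr_eq0 -normr_eq0 -isoj linearB jyx subrr normr0 //.
congr (_ @` _); apply/seteqP; split=> x; last exact: isoJ.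
exact: norm_orth_ker (adjoint_pairC JA) cJ _.
Qed.

Lemma parent_proj_commuteP :
  parent_proj P (Some n) \o parent_proj P None =1 parent_proj P None \o parent_proj P (Some n) <->
  (forall x, J n (adjoint (J n) (J n x)) = J n x).
Proof.
have := range_isometries_commuteP isoi isoj.
by move=> h; apply: iff_trans (iff_sym h) _; rewrite -JadjE -JE.
Qed.

End ParentSpaces.

(** * The Hilbert space l2 *)

(* The library attaches the topology of a field only to abstract fields and to
   regular modules, so that limits in [R[i]] need it to be copied. *)
HB.instance Definition _ (R : realType) := NormedModule.copy R[i] R[i]^o.

Section ComplexLimits.
Variable R : realType.
Local Notation C := R[i].
Local Notation Re := complex.Re.
Local Notation Im := complex.Im.

Lemma cvg_complexD (u v : nat -> C) (a b : C) :
  u n @[n --> \oo] --> a -> v n @[n --> \oo] --> b -> (u n + v n) @[n --> \oo] --> a + b.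
Proof. by move=> ua vb; exact: (cvgD ua vb). Qed.

Lemma cvg_complexM (u v : nat -> C) (a b : C) :
  u n @[n --> \oo] --> a -> v n @[n --> \oo] --> b -> (u n * v n) @[n --> \oo] --> a * b.
Proof. by move=> ua vb; exact: (cvgM ua vb). Qed.

Lemma cvg_complexZ (u : nat -> C) (a c : C) :
  u n @[n --> \oo] --> a -> (c * u n) @[n --> \oo] --> c * a.
Proof. by apply: cvg_complexM; exact: cvg_cst. Qed.

Lemma cvg_complexB (u v : nat -> C) (a b : C) :
  u n @[n --> \oo] --> a -> v n @[n --> \oo] --> b -> (u n - v n) @[n --> \oo] --> a - b.
Proof. by move=> ua vb; exact: (cvgB ua vb). Qed.

Lemma cvg_complex_unique (u : nat -> C) (a b : C) :
  u n @[n --> \oo] --> a -> u n @[n --> \oo] --> b -> a = b.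
Proof. by move=> ua ub; exact: (cvg_unique (@norm_hausdorff C C) ua ub). Qed.

Lemma eq_complex_lim (u v : nat -> C) (a b : C) : u =1 v ->
  u n @[n --> \oo] --> a -> v n @[n --> \oo] --> b -> a = b.
Proof. by move=> /funext ->; exact: cvg_complex_unique. Qed.

Lemma cvg_real_complex (u : nat -> R) (l : R) :
  u n @[n --> \oo] --> l -> (u n)%:C%C @[n --> \oo] --> (l%:C%C : C).
Proof.
move=> ul; apply/cvgrPdist_lt => _ /gt0_real[e e0 ->].
move/cvgrPdist_lt : ul => /(_ _ e0); apply: filterS => n.
by rewrite -rmorphB normc_def/= expr0n addr0 sqrtr_sqr ltcR.
Qed.

Lemma cvg_Re (u : nat -> C) (l : C) :
  u n @[n --> \oo] --> l -> Re (u n) @[n --> \oo] --> Re l.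
Proof.
move=> ul; apply/cvgrPdist_lt => e e0.
have e0' : 0 < e%:C%C :> C by rewrite ltcR.
move/cvgrPdist_lt : ul => /(_ _ e0'); apply: filterS => n.
by rewrite -ReB -(ltcR `|_|); exact: le_lt_trans (normc_ge_Re _).
Qed.

Lemma cvg_complexP (u : nat -> C) (a b : R) :
  Re (u n) @[n --> \oo] --> a -> Im (u n) @[n --> \oo] --> b ->
  u n @[n --> \oo] --> (Complex a b).
Proof.
move=> ua ub; rewrite [Complex a b]complexE/=.
rewrite (_ : u = fun n => (Re (u n))%:C%C + 'i%C * (Im (u n))%:C%C); last first.
  by apply/funext => n; exact: complexE.
apply: cvg_complexD; first exact: cvg_real_complex.
exact/cvg_complexZ/cvg_real_complex.
Qed.

(** Nonnegativity in [R[i]] includes being real, so the limit is first identified with its own real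
    part. *)
Lemma limC_ge0 (u : nat -> C) (l : C) :
  (\forall n \near \oo, 0 <= u n) -> u n @[n --> \oo] --> l -> 0 <= l.
Proof.
move=> u0 ul; have uRe := cvg_Re ul.
have lRe : l = (Re l)%:C%C.
  have ul' : u n @[n --> \oo] --> ((Re l)%:C%C : C).
    apply: cvg_trans (cvg_real_complex uRe); apply: near_eq_cvg.
    by near=> n; rewrite ge0_Re//; near: n.
  exact: cvg_complex_unique ul ul'.
rewrite lRe lecR.
apply: (@ler_cvg_to _ _ _ _ (fun=> 0) (fun n => Re (u n))) uRe _; first exact: cvg_cst.
by apply: filterS u0 => n /Re_le.
Unshelve. all: by end_near. Qed.

Lemma limC_le (u v : nat -> C) (a b : C) :
  (\forall n \near \oo, u n <= v n) ->
  u n @[n --> \oo] --> a -> v n @[n --> \oo] --> b -> a <= b.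
Proof.
move=> uv ua vb; rewrite -subr_ge0.
apply: (@limC_ge0 (fun n => v n - u n)); last exact: cvg_complexB.
by apply: filterS uv => n; rewrite subr_ge0.
Qed.

Lemma cvg_bounded_nneg_series (F : nat -> C) (M : R) :
  (forall k, 0 <= F k) -> (forall n, \sum_(k < n) F k <= M%:C%C) ->
  cvg ((\sum_(k < n) F k) @[n --> \oo]).
Proof.
move=> F0 FM; pose s n := \sum_(k < n) Re (F k).
have sE : (fun n => \sum_(k < n) F k) = fun n => (s n)%:C%C.
  by apply/funext => n; rewrite /s rmorph_sum/=; apply: eq_bigr => k _; rewrite ge0_Re.
have : cvg (s n @[n --> \oo]).
  apply: nondecreasing_is_cvgn.
    apply/nondecreasing_seqP => n; rewrite /s big_ord_recr/= lerDl.
    by have := Re_le (F0 n).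
  exists M => _ [n _ <-]; have := FM n.
  by rewrite (congr1 (@^~ n) sE) lecR.
by move=> /cvg_ex[l sl]; apply/cvg_ex; exists l%:C%C; rewrite sE; exact: cvg_real_complex.
Qed.

Lemma cvg_sum_ord (K : nat) (u : 'I_K -> nat -> C) (l : 'I_K -> C) :
  (forall k, u k n @[n --> \oo] --> l k) ->
  (\sum_(k < K) u k n) @[n --> \oo] --> \sum_(k < K) l k.
Proof.
elim: K u l => [|K IH] u l ul.
  by rewrite big_ord0; under eq_fun do rewrite big_ord0; exact: cvg_cst.
rewrite big_ord_recr/=; under eq_fun do rewrite big_ord_recr/=.
by apply: cvg_complexD => //; apply: IH => k; exact: ul.
Qed.

Lemma complex_complete (u : nat -> C) :
  (forall e : R, 0 < e -> exists N : nat, forall m n, (N <= m)%N -> (N <= n)%N ->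
     `|u m - u n| < e%:C%C) ->
  exists l : C, u n @[n --> \oo] --> l.
Proof.
move=> cu.
(* Here [h] stands for the real or the imaginary part; only additivity and the Lipschitz bound
   matter. *)
have rc (h : C -> R) : (forall x y, h x - h y = h (x - y)) ->
    (forall x, `|h x|%:C%C <= `|x|) -> cvg (h (u n) @[n --> \oo]).
  move=> hB hle; apply/cauchy_cvgP/cauchy_ballP => e /cu[N HN].
  exists ((h \o u) @` [set n | (N <= n)%N], (h \o u) @` [set n | (N <= n)%N]) => /=.
    by split; exists N => // n Nn; exists n.
  move=> _ /= [[m Nm <-] [n Nn <-]].
  rewrite -ball_normE/= hB -ltcR; exact: le_lt_trans (hle _) (HN _ _ Nm Nn).
have /cvg_ex[a ua] : cvg (Re (u n) @[n --> \oo]).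
  by apply: rc => *; [rewrite ReB|exact: normc_ge_Re].
have /cvg_ex[b ub] : cvg (Im (u n) @[n --> \oo]).
  apply: rc => [[? ?] []//|x].
  by rewrite -normrN -ReiNIm (le_trans (normc_ge_Re _))// normrM complexiE normCi mulr1.
by exists (Complex a b); exact: cvg_complexP.
Qed.

End ComplexLimits.

Section SquareSummable.
Variable R : realType.
Local Notation C := R[i].

(** Bounded partial sums rather than convergent ones, so that closure under linear combinations is a
    finite inequality. The predicate is boolean to let [l2] inherit its module structure as a
    subtype. *)
Definition square_summable : {pred nat -> C} :=
  fun f => `[< exists M : R, forall n, \sum_(k < n) `|f k| ^+ 2 <= M%:C%C >].

Lemma square_summableP (f : nat -> C) : reflect
  (exists M : R, forall n, \sum_(k < n) `|f k| ^+ 2 <= M%:C%C) (f \in square_summable).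
Proof. exact: asboolP. Qed.

Lemma square_summable_submod_closed : submod_closed square_summable.
Proof.
split=> [|a f g /square_summableP[M fM] /square_summableP[N gN]]; apply/square_summableP.
  exists 0 => n; rewrite big1// => k _.
  by rewrite normr0 expr0n.
have [b ab] : exists b : R, `|a| ^+ 2 = b%:C%C.
  by exists (complex.Re (`|a| ^+ 2)); rewrite ge0_Re// exprn_ge0.
(* The factor 2 is that of the parallelogram law, whose term in [x - y] is dropped. *)
exists (2 * (b * M + N)) => n.
rewrite rmorphM rmorph_nat rmorphD rmorphM/= -ab.
apply: (@le_trans _ _ (2 * (`|a| ^+ 2 * \sum_(k < n) `|f k| ^+ 2 + \sum_(k < n) `|g k| ^+ 2))).
  rewrite mulr_sumr -big_split mulr_sumr; apply: ler_sum => k _.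
  rewrite -exprMn -normrM !fctE/=.
  set x := a * f k; set y := g k.
  have -> : 2 * (`|x| ^+ 2 + `|y| ^+ 2) = `|x + y| ^+ 2 + `|x - y| ^+ 2.
    by rewrite !normCK !rmorphD rmorphN/=; ring.
  by rewrite lerDl exprn_ge0.
rewrite ler_pM2l// lerD//.
by rewrite ler_wpM2l ?exprn_ge0.
Qed.

HB.instance Definition _ := GRing.isSubmodClosed.Build _ _ square_summable
  square_summable_submod_closed.

Record l2 := L2 { l2fun :> nat -> C; l2funP : l2fun \in square_summable }.

HB.instance Definition _ := [isSub for l2fun].
HB.instance Definition _ := [Choice of l2 by <:].
HB.instance Definition _ := [SubChoice_isSubLmodule of l2 by <:].

Implicit Types f g h : l2.

Lemma l2P f g : f =1 g -> f = g.
Proof. by move=> fg; apply/val_inj/funext. Qed.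

Lemma l2D f g k : l2fun (f + g) k = f k + g k. Proof. by []. Qed.
Lemma l2N f k : l2fun (- f) k = - f k. Proof. by []. Qed.
Lemma l2B f g k : l2fun (f - g) k = f k - g k. Proof. by []. Qed.
Lemma l2Z a f k : l2fun (a *: f) k = a * f k. Proof. by []. Qed.

Let part f g n := \sum_(k < n) f k * (g k)^*.

Let is_cvg_part f g : cvg (part f g n @[n --> \oo]).
Proof.
have sq h : cvg ((\sum_(k < n) `|h k| ^+ 2) @[n --> \oo]).
  have /square_summableP[M hM] := l2funP h.
  by apply: (@cvg_bounded_nneg_series R (fun k => `|h k| ^+ 2) M) hM => k; rewrite exprn_ge0.
have /cvg_ex[a aP] := sq (f + g).
have /cvg_ex[b bP] := sq (f - g).
have /cvg_ex[c cP] := sq (f + 'i *: g).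
have /cvg_ex[d dP] := sq (f - 'i *: g).
(* Polarization reduces convergence to series with nonnegative terms. *)
have h := cvg_complexZ (c := 4^-1)
  (cvg_complexD (cvg_complexB aP bP) (cvg_complexZ (c := 'i) (cvg_complexB cP dP))).
apply/cvg_ex; eexists.
apply: cvg_trans h; apply: near_eq_cvg; near=> n.
rewrite -!sumrB mulr_sumr -big_split mulr_sumr; apply: eq_bigr => k _.
rewrite !(l2D, l2N, l2Z) !normCK !(rmorphD, rmorphN, rmorphM)/= conjCi.
have i2 : 'i * 'i = -1 :> C by rewrite -expr2 sqrCi.
set x := f k; set y := g k; set x' := x^*; set y' := y^*.
transitivity (4^-1 * (2 * (x * y' + y * x') + ('i * 'i) * 2 * (y * x' - x * y'))); first by ring.
by rewrite i2; field.
Unshelve. all: by end_near. Qed.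

Definition l2_inner f g : C := lim (part f g n @[n --> \oo]).

Lemma l2_innerP f g : (\sum_(k < n) f k * (g k)^*) @[n --> \oo] --> l2_inner f g.
Proof. exact: is_cvg_part. Qed.

Arguments l2_innerP : clear implicits.

Lemma l2_innerPl a f g h : l2_inner (a *: f + g) h = a * l2_inner f h + l2_inner g h.
Proof.
apply: (eq_complex_lim _ (l2_innerP (a *: f + g) h)
  (cvg_complexD (cvg_complexZ (c := a) (l2_innerP f h)) (l2_innerP g h))) => n.
rewrite mulr_sumr -big_split; apply: eq_bigr => k _.
by rewrite l2D l2Z mulrDl mulrA.
Qed.

Lemma l2_innerC f g : l2_inner f g = (l2_inner g f)^*.
Proof.
have cc (u : nat -> C) l : u n @[n --> \oo] --> l -> (u n)^* @[n --> \oo] --> l^*.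
  move=> /cvgrPdist_lt ul; apply/cvgrPdist_lt => e /ul; apply: filterS => n.
  by rewrite -rmorphB norm_conjC.
apply: (eq_complex_lim _ (l2_innerP f g) (cc _ _ (l2_innerP g f))) => n.
by rewrite rmorph_sum; apply: eq_bigr => k _; rewrite rmorphM/= conjCK mulrC.
Qed.

Lemma l2_inner_part f n : \sum_(k < n) `|f k| ^+ 2 <= l2_inner f f.
Proof.
apply: (limC_le _ (@cvg_cst C (\sum_(k < n) `|f k| ^+ 2) nat \oo _) (l2_innerP f f)).
exists n => // m /= nm; rewrite -(subnKC nm) big_split_ord/=.
rewrite (eq_bigr (fun k : 'I_n => f k * (f k)^*)) => [|k _]; last exact: normCK.
by rewrite lerDl sumr_ge0// => k _; rewrite -normCK exprn_ge0.
Qed.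

Lemma l2_inner_le f (M : C) : (\forall n \near \oo, \sum_(k < n) `|f k| ^+ 2 <= M) ->
  l2_inner f f <= M.
Proof.
move=> fM; apply: (limC_le _ (l2_innerP f f) (@cvg_cst C M nat \oo _)).
by apply: filterS fM => n; under eq_bigr do rewrite normCK.
Qed.

Lemma l2_inner_coord f k : `|f k| ^+ 2 <= l2_inner f f.
Proof.
apply: le_trans (l2_inner_part f k.+1).
by rewrite big_ord_recr/= lerDr sumr_ge0// => j _; rewrite exprn_ge0.
Qed.

Lemma l2_inner_gt0 f : f != 0 -> 0 < l2_inner f f.
Proof.
move=> f0; have [k fk] : exists k, f k != 0.
  apply: contrapT => nk; move/eqP: f0; apply; apply: l2P => k.
  by apply/eqP/negPn/negP => fk; apply: nk; exists k.
by apply: lt_le_trans (l2_inner_coord f k); rewrite exprn_gt0// normr_gt0.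
Qed.

Lemma l2_inner_bilinear : bilinear_for
  ( *%R : GRing.Scale.law C C) (@Num.conj C \; *%R : GRing.Scale.law C C) l2_inner.
Proof.
split=> [h a f g|h a f g]/=; first exact: l2_innerPl.
by rewrite l2_innerC l2_innerPl rmorphD rmorphM/= -!l2_innerC.
Qed.

HB.instance Definition _ := bilinear_isBilinear.Build _ _ _ _ _ _ l2_inner l2_inner_bilinear.

Lemma l2_inner_hermitian f g : l2_inner f g = (-1) ^+ false * (l2_inner g f)^*.
Proof. by rewrite expr0 mul1r l2_innerC. Qed.

HB.instance Definition _ := isHermitianSesquilinear.Build C l2 false _ l2_inner l2_inner_hermitian.
HB.instance Definition _ := isDotProduct.Build C l2 l2_inner l2_inner_gt0.

Definition l2_dot : {dot l2 for @Num.conj C} := l2_inner.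

Definition l2_norm f : C := sqrtC (l2_inner f f).

HB.instance Definition _ := @Lmodule_isNormed.Build C l2 l2_norm
  (ler_dot_sqrtD l2_dot) (dot_sqrtZ l2_dot) (dot_sqrt_eq0 (f := l2_dot)).

Lemma l2_normE f : `|f| ^+ 2 = l2_inner f f.
Proof. exact: sqrtCK. Qed.

End SquareSummable.

(** * Completeness of l2 *)

Section L2Complete.
Variable R : realType.
Local Notation C := R[i].
Local Notation l2 := (l2 R).
Implicit Types f g h : l2.

(** Choose in [F] a ball of radius [n.+1%:R^-1] around some [u n] for each [n]. Any two of these
    balls meet because [F] is proper, so [u] is Cauchy, and [F] converges to its limit. *)
Lemma cauchy_seq_cvg (V : normedModType C) (F : set_system V) :
  (forall u : nat -> V,
    (forall e : R, 0 < e -> exists N : nat, forall m n, (N <= m)%N -> (N <= n)%N ->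
      rnorm (u m - u n) < e) ->
    exists l : V, forall e : R, 0 < e ->
      exists N : nat, forall n, (N <= n)%N -> rnorm (u n - l) < e) ->
  ProperFilter F -> cauchy F -> cvg F.
Proof.
move=> complV FF /cauchyP cF.
have inv0 e : 0 < e -> exists N : nat, forall n, (N <= n)%N -> n.+1%:R^-1 < e :> R.
  by move=> e0; have [N _ HN] := near_infty_natSinv_lt (PosNum e0); exists N => n; exact: HN.
have /choice[u uF] (n : nat) : exists x, F (ball x (n.+1%:R^-1)%:C%C).
  by apply: cF; rewrite ltcR invr_gt0.
have bE (x : V) (e : R) y : ball x e%:C%C y = (rnorm (x - y) < e) :> Prop.
  by rewrite -ball_normE/= rnormE ltcR.
have [l ul] : exists l : V, forall e : R, 0 < e ->
    exists N : nat, forall n, (N <= n)%N -> rnorm (u n - l) < e.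
  apply: complV => e e0; have [N HN] := inv0 (e / 2) (divr_gt0 e0 (ltr0Sn _ 1)).
  exists N => m n Nm Nn.
  have /filter_ex[y []] : F (ball (u m) (m.+1%:R^-1)%:C%C `&` ball (u n) (n.+1%:R^-1)%:C%C).
    exact: filterI (uF m) (uF n).
  rewrite !bE (rnormC (u n)) => umy uny.
  rewrite (le_lt_trans (ler_rnormB _ y _))// [ltRHS]splitr ltrD//.
    exact: lt_trans umy (HN m Nm).
  exact: lt_trans uny (HN n Nn).
apply/cvg_ex; exists l; apply/cvgrPdist_lt => _ /gt0_real[e e0 ->].
have e20 : 0 < e / 2 by rewrite divr_gt0.
have [N HN] := inv0 _ e20; have [N' HN'] := ul _ e20.
apply: filterS (uF (maxn N N')) => y; rewrite bE rnormE ltcR.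
move=> uy; rewrite (le_lt_trans (ler_rnormB _ (u (maxn N N')) _))// [ltRHS]splitr ltrD//.
  by rewrite rnormC HN' ?leq_maxr.
exact: lt_trans uy (HN _ (leq_maxl N N')).
Qed.

Lemma l2_sqr f : l2_inner f f = (rnorm f ^+ 2)%:C%C.
Proof. by rewrite -l2_normE rnormE rmorphXn. Qed.

Lemma l2_rnorm_le f (e : R) : 0 <= e ->
  (forall n, \sum_(k < n) `|f k| ^+ 2 <= (e ^+ 2)%:C%C) -> rnorm f <= e.
Proof.
move=> e0 fe; rewrite -(@ler_pXn2r _ 2)// ?nnegrE ?rnorm_ge0//.
by rewrite -lecR -l2_sqr; apply: l2_inner_le; near=> n.
Unshelve. all: by end_near. Qed.

(** The candidate [g] is the coordinatewise limit. The Cauchy bound on a sum of [K] terms survives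
    the limit in [m], uniformly in [K]. *)
Lemma l2_seq_complete (u : nat -> l2) :
  (forall e : R, 0 < e -> exists N : nat, forall m n, (N <= m)%N -> (N <= n)%N ->
      rnorm (u m - u n) < e) ->
  exists l : l2, forall e : R, 0 < e -> exists N : nat, forall n, (N <= n)%N -> rnorm (u n - l) < e.
Proof.
move=> cu.
have /choice[g ug] (k : nat) : exists l : C, u n k @[n --> \oo] --> l.
  apply: complex_complete => e /cu[N HN]; exists N => m n Nm Nn.
  apply: le_lt_trans (_ : `|u m - u n| < _); last by rewrite rnormE ltcR HN.
  by have := l2_inner_coord (u m - u n) k; rewrite -l2_normE ler_pXn2r// nnegrE.
have ge e : 0 < e -> exists N : nat, forall n K, (N <= n)%N ->
    \sum_(k < K) `|u n k - g k| ^+ 2 <= (e ^+ 2)%:C%C.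
  move=> e0; have [N HN] := cu _ e0; exists N => n K Nn.
  have h : (\sum_(k < K) `|u n k - u m k| ^+ 2) @[m --> \oo] -->
      (\sum_(k < K) `|u n k - g k| ^+ 2 : C).
    apply: cvg_sum_ord => k.
    have h1 : `|u n k - u m k| @[m --> \oo] --> (`|u n k - g k| : C).
      exact: (cvg_norm (cvg_complexB (@cvg_cst C (u n k) nat \oo _) (ug k))).
    exact: (cvg_complexM h1 h1).
  apply: (limC_le _ h (@cvg_cst C _ nat \oo _)).
  exists N => // m /= Nm; apply: le_trans (l2_inner_part (u n - u m) K) _.
  by rewrite l2_sqr lecR ler_pXn2r ?nnegrE ?rnorm_ge0 ?(ltW e0)// ltW// HN.
have [N HN] := ge 1 ltr01.
(* Only differences with [g] are controlled, so the limit is built as [u N - d], which is square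
   summable by linearity. *)
have dS : (fun k => u N k - g k) \in @square_summable R.
  by apply/square_summableP; exists (1 ^+ 2) => K; exact: HN.
pose d := L2 dS; exists (u N - d) => e e0.
have [N' HN'] := ge (e / 2) (divr_gt0 e0 (ltr0Sn _ 1)).
exists N' => n Nn; apply: (@le_lt_trans _ _ (e / 2)); last by lra.
apply: l2_rnorm_le => [|K]; first by rewrite divr_ge0// ltW.
apply: le_trans (HN' n K Nn); apply: ler_sum => k _.
by rewrite !l2B subKr.
Qed.

Lemma l2_cauchy_cvg (F : set_system l2) : ProperFilter F -> cauchy F -> cvg F.
Proof. by apply: cauchy_seq_cvg; exact: l2_seq_complete. Qed.

HB.instance Definition _ := Uniform_isComplete.Build l2 l2_cauchy_cvg.

HB.instance Definition _ := @NormedModule_isHilbert.Build R l2 (l2_dot R) (@l2_normE R).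

End L2Complete.

(** * Separability of l2 *)

Section L2Separable.
Variable R : realType.
Local Notation C := R[i].

Lemma finsupp_square_summable (u : nat -> C) (N : nat) :
  (forall k, (N <= k)%N -> u k = 0) -> u \in @square_summable R.
Proof.
move=> u0; apply/square_summableP; exists (complex.Re (\sum_(k < N) `|u k| ^+ 2)) => n.
rewrite ge0_Re; last by rewrite sumr_ge0// => k _; rewrite exprn_ge0.
apply: (@le_trans _ _ (\sum_(k < N + n) `|u k| ^+ 2)).
  by rewrite addnC big_split_ord/= lerDl sumr_ge0// => k _; rewrite exprn_ge0.
rewrite big_split_ord/= [X in _ + X]big1 ?addr0// => k _.
by rewrite u0 ?leq_addr// normr0 expr0n.
Qed.

Definition rat_complex (q : rat * rat) : C := Complex (ratr q.1) (ratr q.2).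

Lemma rat_complex_dense (z : C) (e : R) : 0 < e -> exists q, `|z - rat_complex q| < e%:C%C.
Proof.
move=> e0; have e20 : 0 < e / 2 by rewrite divr_gt0.
have ap (x : R) : exists q : rat, `|x - ratr q| < e / 2.
  have [|q] := @rat_in_itvoo R (x - e / 2) (x + e / 2); first by lra.
  by rewrite in_itv/= => /andP[? ?]; exists q; rewrite ltr_norml; lra.
case: z => a b; have [p pa] := ap a; have [q qb] := ap b; exists (p, q).
have -> : Complex a b - rat_complex (p, q) = (a - ratr p)%:C%C + 'i%C * (b - ratr q)%:C%C.
  by rewrite [LHS]complexE.
rewrite (le_lt_trans (ler_normD _ _))// normrM complexiE normCi mul1r.
rewrite !normc_def/= expr0n/= !addr0 !sqrtr_sqr -rmorphD ltcR.
by rewrite [ltRHS]splitr ltrD.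
Qed.

(** The countable dense set consists of the finite sequences with rational real and imaginary parts,
    padded by 0. *)
Lemma l2_separable : separable_space (l2 R).
Proof.
pose v (s : seq (rat * rat)) k := nth (0 : C) [seq rat_complex q | q <- s] k.
have vS s : v s \in @square_summable R.
  by apply: (@finsupp_square_summable _ (size s)) => k sk; rewrite /v nth_default// size_map.
exists (range (fun s => L2 (vS s)));
  first exact: (sub_countable (card_image_le _ _) (countableP _)).
move=> O [f Of] Oo; have /nbhs_ballP[_ /gt0_real[e e0 ->] feO] := open_nbhs_nbhs (conj Oo Of).
have [K HK] : exists K : nat, forall n, \sum_(k < n) `|f (K + k)%N| ^+ 2 <= (e ^+ 2 / 4)%:C%C.
  have d0 : 0 < (e ^+ 2 / 4)%:C%C :> C by rewrite ltcR divr_gt0// exprn_gt0.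
  have /cvgrPdist_le/(_ _ d0)[K _ KP] := @l2_innerP R f f.
  exists K => n; have := KP K (leqnn _); have := KP (K + n)%N (leq_addr _ _).
  have sE m : \sum_(k < m) f k * (f k)^* = \sum_(k < m) `|f k| ^+ 2.
    by apply: eq_bigr => k _; rewrite normCK.
  have s0 m : 0 <= l2_inner f f - \sum_(k < m) `|f k| ^+ 2.
    by rewrite subr_ge0 l2_inner_part.
  rewrite /= !sE !(ger0_norm (s0 _)) => _; apply: le_trans.
  by rewrite lerBrDl; have := l2_inner_part f (K + n); rewrite big_split_ord.
(* The [K] leading coordinates, each off by at most [d] in square, and the tail beyond [K]
   contribute at most [e ^+ 2 / 4] each; [K.+1] avoids division by 0. *)
pose d := e ^+ 2 / 4 / K.+1%:R.
have d0 : 0 < d by rewrite !divr_gt0// exprn_gt0.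
have /choice[q fq] (k : nat) : exists q, `|f k - rat_complex q| < (Num.sqrt d)%:C%C.
  by apply: rat_complex_dense; rewrite sqrtr_gt0.
exists (L2 (vS (mkseq q K))); split; last by exists (mkseq q K).
apply: feO; rewrite -ball_normE/= rnormE ltcR.
apply: (@le_lt_trans _ _ (Num.sqrt (e ^+ 2 / 2))).
  apply: l2_rnorm_le => [|n]; first exact: sqrtr_ge0.
  rewrite sqr_sqrtr ?divr_ge0 ?exprn_ge0 ?(ltW e0)//.
  set g := f - _; apply: (@le_trans _ _ (\sum_(k < K + n) `|g k| ^+ 2)).
    by rewrite addnC big_split_ord/= lerDl sumr_ge0// => k _; rewrite exprn_ge0.
  have gE k : g k = f k - v (mkseq q K) k by rewrite /g l2B.
  rewrite big_split_ord.
  have -> : e ^+ 2 / 2 = e ^+ 2 / 4 + e ^+ 2 / 4 by field.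
  rewrite rmorphD lerD//; last first.
    apply: le_trans (HK n); rewrite le_eqVlt; apply/orP; left; apply/eqP.
    apply: eq_bigr => k _; rewrite gE /v nth_default ?subr0//.
    by rewrite size_map size_mkseq leq_addr.
  apply: (@le_trans _ _ (\sum_(k < K) d%:C%C)).
    apply: ler_sum => k _; rewrite gE /v/=.
    rewrite (nth_map (0, 0)) ?size_mkseq ?ltn_ord// nth_mkseq ?ltn_ord//.
    have sd0 : 0 <= (Num.sqrt d)%:C%C :> C by rewrite ler0c sqrtr_ge0.
    have sdE : (Num.sqrt d)%:C%C ^+ 2 = d%:C%C :> C by rewrite -rmorphXn/= sqr_sqrtr// ltW.
    by rewrite -sdE ler_pXn2r ?nnegrE ?normr_ge0 ?sd0//; exact: ltW (fq k).
  rewrite sumr_const card_ord -rmorphMn lecR -mulr_natr /d mulrAC -[X in X <= _]mulrA.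
  by rewrite ler_piMr ?divr_ge0 ?exprn_ge0 ?(ltW e0)// ler_pdivrMr// mul1r ler_nat.
rewrite -[ltRHS](ger0_norm (ltW e0)) -sqrtr_sqr ltr_sqrt ?exprn_gt0//.
by rewrite ltr_pdivrMr// ltr_pMr ?exprn_gt0// ltr1n.
Qed.

End L2Separable.

(** * Positive semidefinite kernels *)

Section Kernels.
Variables (C : numClosedFieldType) (X : Type).
Implicit Types (K : X -> X -> C) (s : seq (C * X)).

Definition hermitian_kernel K := forall x y, K x y = (K y x)^*.

Definition psd_kernel K := forall s,
  0 <= \sum_(u <- s) \sum_(v <- s) u.1 * v.1^* * K u.2 v.2.

(** Squared distance between the vectors that [K] is the Gram kernel of. *)
Definition kernel_dist K x y := K x x + K y y - K x y - K y x.

(* When [K e e = 0] the division gives [0], which is the right value since then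
   [K x e = 0] for all [x]. *)
Definition schur K e x y := K x y - K x e * K e y / K e e.

Section psd.
Variables (K : X -> X -> C) (hK : hermitian_kernel K) (pK : psd_kernel K).

Lemma psd_kernel_ge0 x : 0 <= K x x.
Proof. by have := pK [:: (1, x)]; rewrite !big_seq1 /= rmorph1 !mul1r. Qed.

Lemma psd_kernel_pair a b x y :
  0 <= a * a^* * K x x + b * b^* * K y y + (a * b^* * K x y + b * a^* * K y x).
Proof.
have := pK [:: (a, x); (b, y)]; rewrite !big_cons !big_nil/= !addr0.
by move/le_trans; apply; rewrite le_eqVlt; apply/orP; left; apply/eqP; ring.
Qed.

(** Otherwise weights 1 at [x] and [- (t * K x e)] at [e] give the value [c - 2 * (t * n)]; the
    chosen [t] makes it [- (c + 2)], which is negative. *)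
Lemma psd_kernel_eq0 e x : K e e = 0 -> K x e = 0.
Proof.
move=> e0; apply/eqP/negPn/negP => xe.
pose n := K x e * (K x e)^*.
have n0 : 0 < n by rewrite /n -normCK exprn_gt0// normr_gt0.
pose c := K x x; have c0 : 0 <= c := psd_kernel_ge0 x.
pose t := (c + 1) / n.
have tr : t^* = t by rewrite geC0_conj// divr_ge0// ?addr_ge0// ltW.
have tJ : (- (t * K x e))^* = - (t * (K x e)^*) by rewrite rmorphN rmorphM/= tr.
have := psd_kernel_pair 1 (- (t * K x e)) x e.
rewrite tJ e0 mulr0 addr0 (hK e x) rmorph1 !mul1r -/c.
have -> : c + (- (t * (K x e)^*) * K x e + - (t * K x e) * 1 * (K x e)^*) = c - 2 * (t * n).
  by rewrite /n; ring.
rewrite /t divfK ?gt_eqF//.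
have -> : c - 2 * (c + 1) = - (c + 2) by ring.
by rewrite oppr_ge0 => /(lt_le_trans (ltr_wpDl c0 (ltr0Sn _ 1))); rewrite ltxx.
Qed.

Lemma schur_hermitian e : hermitian_kernel (schur K e).
Proof.
move=> x y; rewrite /schur rmorphB rmorphM fmorphV/= rmorphM/=.
by rewrite -!hK [K x e * _]mulrC.
Qed.

(** Completing the square: the form of [schur K e] on [s] is that of [K] on [s] with [e] adjoined,
    weighted by [- (S / K e e)], the minimising coefficient. *)
Lemma schur_psd e : psd_kernel (schur K e).
Proof.
move=> s; have [e0|e0] := eqVneq (K e e) 0.
  rewrite (_ : schur K e = K)//; apply/funext => x; apply/funext => y.
  by rewrite /schur e0 invr0 mulr0 subr0.
pose S := \sum_(u <- s) u.1 * K u.2 e.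
have SJ : \sum_(v <- s) v.1^* * K e v.2 = S^*.
  by rewrite rmorph_sum; apply: eq_bigr => v _; rewrite rmorphM/= -hK.
pose t := - (S / K e e).
have eJ : (K e e)^* = K e e by rewrite -hK.
have := pK ((t, e) :: s); rewrite big_cons big_cons/=.
have -> : \sum_(v <- s) t * v.1^* * K e v.2 = t * S^*.
  by rewrite -SJ mulr_sumr; apply: eq_bigr => v _; rewrite mulrA.
have -> : \sum_(u <- s) \sum_(v <- (t, e) :: s) u.1 * v.1^* * K u.2 v.2 =
    t^* * S + \sum_(u <- s) \sum_(v <- s) u.1 * v.1^* * K u.2 v.2.
  rewrite mulr_sumr -big_split; apply: eq_bigr => u _.
  by rewrite big_cons/= mulrA [t^* * _]mulrC.
have -> : \sum_(u <- s) \sum_(v <- s) u.1 * v.1^* * schur K e u.2 v.2 =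
    \sum_(u <- s) \sum_(v <- s) u.1 * v.1^* * K u.2 v.2 - S * S^* / K e e.
  rewrite -SJ /S !mulr_suml -sumrB; apply: eq_bigr => u _.
  rewrite mulr_sumr mulr_suml -sumrB; apply: eq_bigr => v _.
  by rewrite /schur; field.
set Q := \sum_(u <- s) _.
have -> : t^* = - (S^* / K e e) by rewrite /t rmorphN rmorphM fmorphV/= eJ.
move/le_trans; apply; rewrite le_eqVlt; apply/orP; left; apply/eqP.
by rewrite /t; field.
Qed.

Lemma psd_kernel_CauchySchwarz x y : `|K x y| ^+ 2 <= K x x * K y y.
Proof.
have [y0|y0] := eqVneq (K y y) 0.
  by rewrite psd_kernel_eq0// normr0 expr0n y0 mulr0.
have yy : 0 < K y y by rewrite lt_def y0 psd_kernel_ge0.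
have := schur_psd y [:: (1, x)]; rewrite !big_seq1/= rmorph1 !mul1r /schur subr_ge0.
by rewrite ler_pdivrMr// normCK -(hK y x).
Qed.

(** Projecting along [e] shortens distances; the loss is the squared modulus of [K x e - K y e] over
    [K e e]. *)
Lemma schur_dist e x y : kernel_dist (schur K e) x y <= kernel_dist K x y.
Proof.
rewrite -subr_ge0.
have -> : kernel_dist K x y - kernel_dist (schur K e) x y =
    (K x e - K y e) * (K x e - K y e)^* / K e e.
  by rewrite /kernel_dist /schur rmorphB/= -!hK; ring.
by rewrite -normCK divr_ge0 ?exprn_ge0 ?psd_kernel_ge0.
Qed.

Lemma schur_pivot e x : schur K e e x = 0.
Proof.
have [e0|e0] := eqVneq (K e e) 0; last by rewrite /schur; field.
by rewrite /schur (hK e x) psd_kernel_eq0// rmorph0 mulr0 mul0r subrr.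
Qed.

Lemma schur_null e z x : (forall y, K z y = 0) -> schur K e z x = 0.
Proof. by move=> z0; rewrite /schur !z0 !mul0r subrr. Qed.

End psd.

Section iterate.
Variables (K : X -> X -> C) (hK : hermitian_kernel K) (pK : psd_kernel K).
Variable e : nat -> X.

(** Gram kernel of what remains after projecting out the points [e 0], ..., [e (n - 1)]. *)
Fixpoint schur_iter n : X -> X -> C :=
  if n is m.+1 then schur (schur_iter m) (e m) else K.

Lemma schur_iter_hermitian n : hermitian_kernel (schur_iter n).
Proof. by elim: n => //= n IH; exact: schur_hermitian. Qed.

Lemma schur_iter_psd n : psd_kernel (schur_iter n).
Proof. by elim: n => //= n IH; apply: schur_psd => //; exact: schur_iter_hermitian. Qed.

Lemma schur_iter_null n j x : (j < n)%N -> schur_iter n (e j) x = 0.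
Proof.
elim: n x => // n IH x; rewrite ltnS leq_eqVlt => /orP[/eqP ->|jn] /=.
  by apply: schur_pivot; [exact: schur_iter_hermitian|exact: schur_iter_psd].
by apply: schur_null => y; exact: IH.
Qed.

Lemma schur_iter_dist n x y : kernel_dist (schur_iter n) x y <= kernel_dist K x y.
Proof.
elim: n => //= n; apply: le_trans.
by apply: schur_dist; [exact: schur_iter_hermitian|exact: schur_iter_psd].
Qed.

(* The first [n] points are null for the [n]-th kernel, hence its diagonal is its
   own distance to any of them, and distances decrease along Schur complements. *)
Lemma schur_iter_diag_le n j x : (j < n)%N -> schur_iter n x x <= kernel_dist K x (e j).
Proof.
move=> jn; apply: le_trans (schur_iter_dist n x (e j)).
rewrite /kernel_dist (schur_iter_hermitian n x (e j)) !schur_iter_null//.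
by rewrite rmorph0 !subr0 addr0.
Qed.

(** Cholesky factor, that is, the Gram-Schmidt coordinate of [x] along the [n]-th point; a zero
    pivot yields 0 by the convention on division. *)
Definition kernel_coord x n := schur_iter n x (e n) / sqrtC (schur_iter n (e n) (e n)).

(** The sum telescopes: its [n]-th term is the rank-one correction made by the [n]-th Schur
    complement. *)
Lemma sum_kernel_coord x y n :
  \sum_(k < n) kernel_coord x k * (kernel_coord y k)^* = K x y - schur_iter n x y.
Proof.
elim: n => [|n IH]; first by rewrite big_ord0 subrr.
rewrite big_ord_recr/= IH /schur /kernel_coord.
have p0 := psd_kernel_ge0 (schur_iter_psd n) (e n).
rewrite rmorphM fmorphV/= -(schur_iter_hermitian n (e n) y).
rewrite (@geC0_conj _ (sqrtC _)) ?sqrtC_ge0// mulrACA -invfM -expr2 sqrtCK.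
by rewrite opprB addrA addrAC.
Qed.

End iterate.
End Kernels.

(** * Kolmogorov factorisation of a kernel through l2 *)

Section Kolmogorov.
Variables (R : realType) (X : Type).
Local Notation C := R[i].
Variables (K : X -> X -> C) (hK : hermitian_kernel K) (pK : psd_kernel K).
Variable e : nat -> X.
Hypothesis denseK : forall x (d : R), 0 < d -> exists j, kernel_dist K x (e j) <= d%:C%C.

Lemma kernel_coord_summable x : kernel_coord K e x \in @square_summable R.
Proof.
apply/square_summableP; exists (complex.Re (K x x)) => n.
rewrite ge0_Re; last exact: psd_kernel_ge0.
rewrite (eq_bigr (fun k : 'I_n => kernel_coord K e x k * (kernel_coord K e x k)^*)).
  rewrite (sum_kernel_coord hK pK) gerBl.
  exact/psd_kernel_ge0/schur_iter_psd.
by move=> k _; exact: normCK.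
Qed.

Definition feature_map x : l2 R := L2 (kernel_coord_summable x).

(** The remainder [schur_iter n x y] tends to 0: by Cauchy-Schwarz its square is at most the product
    of two diagonal values, one small since [x] is close to some [e j], the other at most
    [K y y]. *)
Lemma inner_feature_map x y : inner (feature_map x) (feature_map y) = K x y.
Proof.
apply: (cvg_complex_unique (@l2_innerP R (feature_map x) (feature_map y))).
apply/cvgrPdist_le => _ /gt0_real[d d0 ->].
have M0 : 0 <= complex.Re (K y y) by have := Re_le (psd_kernel_ge0 pK y).
pose M := complex.Re (K y y).
have [j xj] : exists j, kernel_dist K x (e j) <= (d ^+ 2 / (M + 1))%:C%C.
  by apply: denseK; rewrite divr_gt0 ?exprn_gt0// ltr_wpDl.
(* The point [e j] is null only for the kernels of index greater than [j]. *)
exists j.+1 => // n /= jn.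
rewrite (sum_kernel_coord hK pK) subKr.
have hn := schur_iter_hermitian hK e n; have pn := schur_iter_psd hK pK e n.
have dC : 0 <= d%:C%C :> C by rewrite ler0c ltW.
rewrite -(@ler_pXn2r _ 2)// ?nnegrE//.
apply: le_trans (psd_kernel_CauchySchwarz hn pn x y) _.
apply: (@le_trans _ _ ((d ^+ 2 / (M + 1))%:C%C * M%:C%C)).
  apply: ler_pM; [exact: psd_kernel_ge0|exact: psd_kernel_ge0| |].
    exact: le_trans (schur_iter_diag_le hK pK e x jn) xj.
  rewrite ge0_Re; last exact: psd_kernel_ge0.
  have := sum_kernel_coord hK pK e y y n => /eqP; rewrite eq_sym subr_eq => /eqP ->.
  by rewrite lerDr sumr_ge0// => k _; rewrite -normCK exprn_ge0.
rewrite -rmorphM -rmorphXn lecR mulrAC ler_pdivrMr ?ltr_wpDl//.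
by rewrite ler_pM2l ?exprn_gt0// lerDl.
Qed.

(** The difference [v] of the two sides is orthogonal to all feature vectors and is itself a
    combination of them. *)
Lemma feature_map_linear a x y z :
  (forall w, K z w = a * K x w + K y w) ->
  feature_map z = a *: feature_map x + feature_map y.
Proof.
move=> zxy; apply/eqP; rewrite -subr_eq0; apply/eqP/(dot_eq0 (f := inner)).
set v := _ - _.
have vw w : inner v (feature_map w) = 0.
  by rewrite linearBl linearDl/= innerZl !inner_feature_map zxy subrr.
by rewrite {2}/v linearBr linearDr/= innerZr !vw mulr0 addr0 subrr.
Qed.

End Kolmogorov.

(** The sequence inverts an injection of [D] into the naturals; indices outside its image give 0. *)
Lemma separable_dense_seq (R : realType) (V : hilbertType R) : separable_space V ->
  exists v : nat -> V, forall x (d : R), 0 < d -> exists m, rnorm (x - v m) < d.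
Proof.
move=> [D /countable_injP[f injf] dD].
exists (fun m => xget 0 [set x | D x /\ f x = m]) => x d d0.
have d0' : 0 < d%:C%C :> R[i] by rewrite ltcR.
have [||y [xy Dy]] := dD (ball x d%:C%C).
- by exists x; exact: ballxx.
- exact: ball_open.
exists (f y); case: xgetP => [z _ [Dz fzy]|/(_ y)[]//].
have -> : z = y by apply: injf => //; rewrite inE.
by move: xy; rewrite -ball_normE/= rnormE ltcR.
Qed.

Lemma sum_sum_inner (R : realType) (X : Type) (V : hilbertType R) (w : X -> V)
    (s : seq (R[i] * X)) :
  \sum_(u <- s) \sum_(v <- s) u.1 * v.1^* * inner (w u.2) (w v.2) =
  inner (\sum_(u <- s) u.1 *: w u.2) (\sum_(u <- s) u.1 *: w u.2).
Proof.
rewrite linear_sumlz; apply: eq_bigr => u _; rewrite linear_sumr; apply: eq_bigr => v _.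
by rewrite /= innerZl innerZr mulrA.
Qed.

(** * Existence of a factorising parent space *)

Section ParentExists.
Variables (R : realType) (H : option nat -> hilbertType R).
Hypothesis (Hsep : forall k : option nat, separable_space (H k)).
Variables (J : forall k : nat, {linear H (Some k) -> H None}).
Hypothesis (Jcontr : forall k : nat, linear_contraction (J k)).
Local Notation C := R[i].

Let X := {k : option nat & H k}.
Implicit Types u v : X.

Definition to_limit (k : option nat) : H k -> H None :=
  if k is Some k' then J k' else id.

Lemma to_limit_linear k a (x y : H k) : to_limit (a *: x + y) = a *: to_limit x + to_limit y.
Proof. by case: k x y => [k|] x y //=; rewrite linearP. Qed.

Lemma to_limit_contractive k : contractive (@to_limit k).
Proof. by case: k => [k|] x //=; exact: Jcontr. Qed.

(** The form of the defect operator [1 - J_k^* J_k], which vanishes at the index [None]. *)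
Definition defect k (x y : H k) : C := inner x y - inner (to_limit x) (to_limit y).

(** A Kronecker delta across dependent types: the transport along [tag u = k] is needed to compare
    points of different fibres. *)
Definition component k u : H k :=
  match @eqP _ (tag u) k with
  | ReflectT E => eq_rect _ H (tagged u) _ E
  | ReflectF _ => 0
  end.

Lemma component_eq k (x : H k) : component k (Tagged H x) = x.
Proof.
rewrite /component; case: eqP => // E.
by rewrite (eq_axiomK E).
Qed.

Lemma component_neq k u : tag u != k -> component k u = 0.
Proof. by rewrite /component; case: eqP. Qed.

Lemma to_limit0 k : @to_limit k 0 = 0.
Proof. by case: k => [k|] //=; rewrite linear0. Qed.

(** Formally the Gram kernel of [x |-> (J_k x, (1 - J_k^* J_k)^(1/2) x)], the second entries for
    distinct [k] being orthogonal; the kernel needs no operator square root. *)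
Definition parent_kernel u v : C :=
  inner (to_limit (tagged u)) (to_limit (tagged v)) +
  defect (tagged u) (component (tag u) v).

Lemma defect0l k (y : H k) : defect 0 y = 0.
Proof. by rewrite /defect to_limit0 !linear0l subrr. Qed.

Lemma defect0r k (x : H k) : defect x 0 = 0.
Proof. by rewrite /defect to_limit0 !linear0r subrr. Qed.

(** Writing the defect term as a sum over blocks makes it symmetric in [u] and [v], so that
    positivity can be checked block by block. *)
Lemma defect_components (S : seq (option nat)) u v : uniq S -> tag u \in S ->
  defect (tagged u) (component (tag u) v) = \sum_(k <- S) defect (component k u) (component k v).
Proof.
move=> Su uS; rewrite (bigD1_seq _ uS Su)/= big1 ?addr0 => [|k ku].
  by case: u {uS} => k x /=; rewrite (component_eq (x : H k)).
by rewrite component_neq ?defect0l// eq_sym.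
Qed.

(** The sum is the defect form at the single vector [z], nonnegative because [to_limit] is a
    contraction. *)
Lemma sum_sum_defect_ge0 k (s : seq (C * X)) :
  0 <= \sum_(p <- s) \sum_(q <- s) p.1 * q.1^* * defect (component k p.2) (component k q.2).
Proof.
pose z := \sum_(p <- s) p.1 *: component k p.2.
have zE : to_limit z = \sum_(p <- s) p.1 *: to_limit (component k p.2).
  rewrite /z; elim: s {z} => [|u s IH]; first by rewrite !big_nil to_limit0.
  by rewrite !big_cons to_limit_linear IH.
have -> : \sum_(p <- s) \sum_(q <- s) p.1 * q.1^* * defect (component k p.2) (component k q.2)
    = inner z z - inner (to_limit z) (to_limit z).
  rewrite zE -(sum_sum_inner (component k)) -(sum_sum_inner (fun u => to_limit (component k u))).
  rewrite -sumrB; apply: eq_bigr => u _; rewrite -sumrB; apply: eq_bigr => v _.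
  by rewrite /defect mulrBr.
by rewrite subr_ge0 -!normE_inner ler_pXn2r ?nnegrE ?normr_ge0// to_limit_contractive.
Qed.

Lemma parent_kernel_psd : psd_kernel parent_kernel.
Proof.
move=> s; pose S := undup [seq tag p.2 | p <- s].
have -> : \sum_(p <- s) \sum_(q <- s) p.1 * q.1^* * parent_kernel p.2 q.2 =
    inner (\sum_(p <- s) p.1 *: to_limit (tagged p.2))
      (\sum_(p <- s) p.1 *: to_limit (tagged p.2)) +
    \sum_(k <- S) \sum_(p <- s) \sum_(q <- s)
      p.1 * q.1^* * defect (component k p.2) (component k q.2).
  rewrite -(@sum_sum_inner _ _ _ (fun u : X => to_limit (tagged u))).
  rewrite [X in _ + X]exchange_big -big_split /=.
  rewrite [LHS]big_seq [RHS]big_seq; apply: eq_bigr => u us /=.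
  rewrite [X in _ + X]exchange_big -big_split /=; apply: eq_bigr => v _ /=.
  rewrite /parent_kernel (@defect_components S) ?undup_uniq ?mem_undup ?map_f//.
    by rewrite mulrDr mulr_sumr.
  by apply/mapP; exists u.
by rewrite addr_ge0 ?dot_ge0 ?sumr_ge0// => k _; exact: sum_sum_defect_ge0.
Qed.

Lemma parent_kernel_hermitian : hermitian_kernel parent_kernel.
Proof.
move=> [k x] [l y]; rewrite /parent_kernel rmorphD/= -innerC; congr (_ + _).
have [kl|kl] := eqVneq k l.
  subst l; rewrite (component_eq (x : H k)) (component_eq (y : H k)).
  by rewrite /defect rmorphB/= -!innerC.
by rewrite !component_neq/= ?defect0r ?rmorph0// eq_sym.
Qed.

Lemma parent_kernel_same k (x y : H k) :
  parent_kernel (Tagged H x) (Tagged H y) = inner x y.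
Proof. by rewrite /parent_kernel component_eq /defect/= addrC subrK. Qed.

(** The case behind factorisation, as [parent_kernel_same] is the one behind isometry. *)
Lemma parent_kernel_limit k (x : H (Some k)) (y : H None) :
  parent_kernel (Tagged H x) (Tagged H y) = inner (J k x) y.
Proof. by rewrite /parent_kernel component_neq//= defect0r addr0. Qed.

Lemma parent_kernel_linear k a (x y : H k) w :
  parent_kernel (Tagged H (a *: x + y)) w =
  a * parent_kernel (Tagged H x) w + parent_kernel (Tagged H y) w.
Proof.
rewrite /parent_kernel /defect/= !to_limit_linear !linearDl/= !innerZl; ring.
Qed.

Definition dense_point (j : nat) : X :=
  if @unpickle (option nat * nat)%type j is Some (k, m)
  then Tagged H (projT1 (cid (separable_dense_seq (@Hsep k))) m)
  else Tagged H (0 : H None).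

(** On one fibre [kernel_dist] is the squared norm distance, so dense sequences of the fibres,
    enumerated jointly, suffice. *)
Lemma dense_pointP u (d : R) : 0 < d ->
  exists j, kernel_dist parent_kernel u (dense_point j) <= d%:C%C.
Proof.
case: u => k x d0.
have sd0 : 0 < Num.sqrt d by rewrite sqrtr_gt0.
have [m xm] := projT2 (cid (separable_dense_seq (@Hsep k))) x (Num.sqrt d) sd0.
exists (pickle (k, m)); rewrite /dense_point pickleK.
set y := projT1 _ _ in xm *; rewrite -[existT _ k x]/(Tagged H x).
rewrite /kernel_dist !parent_kernel_same.
have -> : inner x x + inner y y - inner x y - inner y x = inner (x - y) (x - y).
  by rewrite dot_sqrB -(innerC y x) opprD addrA.
rewrite -normE_inner rnormE -rmorphXn lecR.
rewrite -(sqr_sqrtr (ltW d0)) ler_pXn2r ?nnegrE ?rnorm_ge0 ?(ltW sd0)//.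
exact: ltW.
Qed.

Definition parent_embedding k (x : H k) : l2 R :=
  feature_map parent_kernel_hermitian parent_kernel_psd dense_point (Tagged H x).

Lemma inner_parent_embedding k l (x : H k) (y : H l) :
  inner (parent_embedding x) (parent_embedding y) = parent_kernel (Tagged H x) (Tagged H y).
Proof. exact/inner_feature_map/dense_pointP. Qed.

Lemma parent_embedding_linear k : linear (@parent_embedding k).
Proof.
move=> a x y; apply: feature_map_linear; first exact: dense_pointP.
by move=> w; exact: parent_kernel_linear.
Qed.

HB.instance Definition _ k := GRing.isLinear.Build C (H k) (l2 R) _ (@parent_embedding k)
  (@parent_embedding_linear k).

Lemma parent_embedding_isometry k (x : H k) : `|parent_embedding x| = `|x|.
Proof. by apply/norm_eq_inner; rewrite inner_parent_embedding parent_kernel_same. Qed.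

Definition kernel_parent : parentSpace H :=
  @ParentSpace R H (l2 R) (@l2_separable R) (fun k => @parent_embedding k)
    parent_embedding_isometry.

Lemma kernel_parent_factorises : factorises kernel_parent J.
Proof.
move=> k x /=; apply: inner_extr => y.
rewrite -adjointP; last by move=> z; rewrite parent_embedding_isometry.
rewrite innerC [RHS]innerC; congr (_^*).
by rewrite inner_parent_embedding parent_kernel_limit.
Qed.

End ParentExists.

Theorem theorem2p15 (R : realType) (H : option nat -> hilbertType R)
    (Hsep : forall k : option nat, separable_space (H k))
    (J : forall k : nat, {linear H (Some k) -> H None})
    (Jcontr : forall k : nat, linear_contraction (J k))
    (n : nat) :
  let Hn' : set (H (Some n)) := orth (ker (J n)) in
  let Hoo' : set (H None) := orth (ker (adjoint (J n))) in
  let meet_ranges (P : parentSpace H) : set P :=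
    range (parent_iota P (Some n)) `&` range (parent_iota P None) in
  [<-> (* (a) *) partial_isometry (J n);
       (* (b) *) exists2 P : parentSpace H, factorises P J &
                   meet_ranges P = parent_iota P (Some n) @` Hn';
                 forall P : parentSpace H, factorises P J ->
                   meet_ranges P = parent_iota P (Some n) @` Hn';
       (* (c) *) exists2 P : parentSpace H, factorises P J &
                   meet_ranges P = parent_iota P None @` Hoo';
                 forall P : parentSpace H, factorises P J ->
                   meet_ranges P = parent_iota P None @` Hoo';
       (* (d) *) exists2 P : parentSpace H, factorises P J &
                   parent_proj P (Some n) \o parent_proj P None =1
                   parent_proj P None \o parent_proj P (Some n);
                 forall P : parentSpace H, factorises P J ->
                   parent_proj P (Some n) \o parent_proj P None =1
                   parent_proj P None \o parent_proj P (Some n)].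
Proof.
move=> Hn' Hoo' meet_ranges.
have P0J := kernel_parent_factorises Hsep Jcontr.
set P0 := kernel_parent _ _ in P0J.
have bP := parent_range_kerP Jcontr; have cP := parent_range_ker_adjointP Jcontr.
have dP := parent_proj_commuteP Jcontr; have aP := partial_isometryP (Jcontr n).
(* In the cycle, each passage to a version for one parent space uses [P0] as witness, and each
   passage to all parent spaces goes through the identity for [J n]. *)
tfae.
- by move/aP => E; exists P0 => //; exact/bP.
- by move=> [P PJ /(bP _ _ PJ) E] Q QJ; exact/(bP _ _ QJ).
- by move=> /(_ _ P0J)/(bP _ _ P0J) E; exists P0 => //; exact/cP.
- by move=> [P PJ /(cP _ _ PJ) E] Q QJ; exact/(cP _ _ QJ).
- by move=> /(_ _ P0J)/(cP _ _ P0J) E; exists P0 => //; exact/dP.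
- by move=> [P PJ /(dP _ _ PJ) E] Q QJ; exact/(dP _ _ QJ).
- by move=> /(_ _ P0J)/(dP _ _ P0J) E; exact/aP.
Qed.
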